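(* Let $(A,\mathbf{B})$ be a noncommutative reality-based algebra of rank $7$ with positive degree map, and let $\chi$ be its (unique) irreducible character of degree $2$. If $\nu(\chi)=-1$, then the structure constants of the standard basis $\mathbf{B}$ are not all algebraic integers. In particular, no association scheme (via its adjacency algebra with the basis of adjacency matrices) is a rank $7$ noncommutative RBA with $\nu(\chi)=-1$.
   Context: A reality-based algebra (RBA) is a pair $(A,\mathbf{B})$ where $A$ is an associative unital $\mathbb{C}$-algebra with a skew-linear involution $*$, $\mathbf{B}=\{b_0=1_A,b_1,\dots,b_{r-1}\}$ is a $*$-invariant basis of $A$ ($r$ is the rank), the structure constants $\lambda_{ijk}$ defined by $b_ib_j=\sum_k\lambda_{ijk}b_k$ are real, and for each $i$, $b_i^*$ is the unique $b_j$ with $\lambda_{ij0}\neq0$, and $\lambda_{ii^*0}=\lambda_{i^*i0}>0$. It has a positive degree map if there is a $*$-algebra homomorphism $\delta:A\to\mathbb{C}$ with $\delta(b_i)>0$ for all $i$; $\mathbf{B}$ is the standard basis, normalized so that the coefficient of $1$ in $b_ib_i^*$ equals $\delta(b_i)$. The order is $n=\sum_i\delta(b_i)$; the standard feasible trace is $\tau(\sum_i\alpha_ib_i)=n\alpha_0$, decomposing as $\tau=\sum_{\psi\in\mathrm{Irr}(A)}m_\psi\psi$ with multiplicities $m_\psi>0$. A noncommutative semisimple algebra of dimension $7$ has irreducible characters of degrees $1,1,1,2$. The Frobenius–Schur indicator is $\nu(\psi)=\frac{m_\psi}{n\psi(b_0)}\sum_{i=0}^{r-1}\frac{\psi(b_i^2)}{\delta(b_i)}$,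 taking values in $\{-1,0,1\}$; $\nu(\psi)=0$ iff $\psi$ is not real-valued, and the number of real basis elements ($b_i^*=b_i$) equals $\sum_{\psi}\nu(\psi)\psi(b_0)$. *)

(* Defs.v *)
From HB Require Import structures.
From mathcomp Require Import all_boot all_order all_algebra.
Set Implicit Arguments. Unset Strict Implicit. Unset Printing Implicit Defensive.
Import Order.TTheory GRing.Theory Num.Theory.
Local Open Scope ring_scope.

(* An algebra A of rank r over the complex-like field C (numClosedFieldType)
   is given by its basis b_0,...,b_(r-1) (indices 'I_r, b_0 = ord0) and
   structure constants lam i j k : b_i b_j = \sum_k lam i j k b_k.
   The involution * on the basis is the index permutation star.           *)

Section RBA.
Variables (C : numClosedFieldType) (r : nat).
Implicit Types (lam : 'I_r.+1 -> 'I_r.+1 -> 'I_r.+1 -> C) (star : 'I_r.+1 -> 'I_r.+1)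
  (delta : 'I_r.+1 -> C).

(* (A, B) is a reality-based algebra with involution star. *)
Definition is_RBA lam star : Prop :=
  (* associativity: (b_i b_j) b_k = b_i (b_j b_k) *)
  (forall i j k m, \sum_l lam i j l * lam l k m = \sum_l lam j k l * lam i l m) /\
  (* b_0 = 1_A *)
  (forall j k, lam ord0 j k = (j == k)%:R /\ lam j ord0 k = (j == k)%:R) /\
  (* real structure constants *)
  (forall i j k, lam i j k \is Num.real) /\
  (* star is an involution on the basis, extending to a skew-linear
     anti-multiplicative involution: (b_i b_j)^* = b_j^* b_i^* *)
  (forall i, star (star i) = i) /\
  (forall i j k, lam (star j) (star i) (star k) = lam i j k) /\
  (* b_i^* is the unique b_j with lam i j 0 <> 0 *)
  (forall i j, lam i j ord0 != 0 <-> j = star i) /\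
  (* lam i i^* 0 = lam i^* i 0 > 0 *)
  (forall i, lam i (star i) ord0 = lam (star i) i ord0 /\ 0 < lam i (star i) ord0).

(* delta is a positive degree map (a *-algebra homomorphism A -> C with
   delta(b_i) > 0) and B is the standard basis w.r.t. delta. *)
Definition is_pos_degree_map lam star delta : Prop :=
  [/\ delta ord0 = 1,
      (forall i j, delta i * delta j = \sum_k lam i j k * delta k),
      (forall i, delta (star i) = (delta i)^*),
      (forall i, 0 < delta i) &
  (* standard basis normalisation *)
      (forall i, lam i (star i) ord0 = delta i)].

Definition noncommutative lam : Prop := exists i j k, lam i j k != lam j i k.

(* order n = sum of degrees *)
Definition rba_order delta : C := \sum_i delta i.

(* standard feasible trace tau(b_i) = n * [i == 0] *)
Definition std_trace delta (i : 'I_r.+1) : C := rba_order delta * (i == ord0)%:R.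

(* an algebra homomorphism A -> C (= irreducible character of degree 1),
   given by its values on the basis *)
Definition is_lin_char lam (psi : 'I_r.+1 -> C) : Prop :=
  psi ord0 = 1 /\ forall i j, psi i * psi j = \sum_k lam i j k * psi k.

(* a representation A -> M_2(C), given by the images of the basis *)
Definition is_rep2 lam (rho : 'I_r.+1 -> 'M[C]_2) : Prop :=
  rho ord0 = 1%:M /\ forall i j, rho i *m rho j = \sum_k lam i j k *: rho k.

(* irreducible: no nonzero proper invariant subspace of C^2 *)
Definition irreducible_rep2 (rho : 'I_r.+1 -> 'M[C]_2) : Prop :=
  forall U : 'M[C]_2, U != 0 -> (forall i, stablemx U (rho i)) -> row_full U.

(* the character of rho *)
Definition char_of (rho : 'I_r.+1 -> 'M[C]_2) (i : 'I_r.+1) : C := \tr (rho i).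

(* m is the multiplicity of chi = char_of rho in the standard trace:
   tau = m * chi + (linear combination of the degree-1 irreducible chars) *)
Definition trace_multiplicity lam delta (rho : 'I_r.+1 -> 'M[C]_2) (m : C) : Prop :=
  exists (psi : 'I_3 -> 'I_r.+1 -> C) (c : 'I_3 -> C),
    (forall t, is_lin_char lam (psi t)) /\
    forall i, std_trace delta i = \sum_t c t * psi t i + m * char_of rho i.

(* Frobenius--Schur indicator nu(chi) = m/(n chi(b_0)) sum_i chi(b_i^2)/delta(b_i) *)
Definition FS_indicator lam delta (rho : 'I_r.+1 -> 'M[C]_2) (m : C) : C :=
  m / (rba_order delta * char_of rho ord0) *
  \sum_i (\sum_k lam i i k * char_of rho k) / delta i.

End RBA.

(* algebraic integer: root of a monic integer polynomial *)
Definition alg_integer (C : numClosedFieldType) (x : C) : Prop :=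
  exists p : {poly int}, p \is monic /\ root (map_poly (fun z : int => z%:~R) p) x.

(* Main.v *)
(* Let R be the 2-dimensional representation, chi its character. Schur's lemma
   gives sum_i R(b_i)_pq R(b_i^* )_st / delta_i = kap [p = t] [q = s] with
   n = m kap, and nu(chi) = -1 forces R(b^* ) to be the adjugate of R(b), so that
   R(b) + R(b^* ) = chi(b). Comparing traces in rank 7, 1 is the only
   *-symmetric basis element, and the elements b - b^* lie in the 2x2 block and
   are orthogonal there. Hence, for b_i not in {1, b_j, b_j^*}, the difference of
   the coefficients of b_j in b_j b_i and b_j^* b_i is chi(b_i) / 2. If all
   structure constants are algebraic integers, so are the chi(b_i) / 2 for
   i <> 0. But sum_i chi(b_i) = 0 and chi(1) = 2, so these numbers, taken once
   for each pair {b_i, b_i^*}, add up to -1/2. *)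
Require Import Defs.
From HB Require Import structures.
From mathcomp Require Import all_boot all_order all_algebra.
From mathcomp Require Import ring.
Set Implicit Arguments. Unset Strict Implicit. Unset Printing Implicit Defensive.
Import Order.TTheory GRing.Theory Num.Theory.
Local Open Scope ring_scope.

(** * Auxiliary facts on traces and integrality *)

(** In a full-rank factorisation E = A B, idempotence forces B A = 1, an identity matrix whose size
    is the rank of E. *)
Lemma mxtrace_idempotent (F : fieldType) n (E : 'M[F]_n) :
  E *m E = E -> \tr E = (\rank E)%:R.
Proof.
have [[L LK] [R RK]] := (row_fullP (col_base_full E), row_freeP (row_base_free E)).
move: (mulmx_base E) L LK R RK; move: (col_base E) (row_base E).
move: (\rank E) => k A B <- L LK R RK idE; rewrite mxtrace_mulC.
suff -> : B *m A = 1%:M by rewrite mxtrace1.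
have := congr1 (fun X => L *m X *m R) idE.
by rewrite !mulmxA LK mul1mx -mulmxA RK mulmx1.
Qed.

(** Derives a goal from one known equation scaled by [c], leaving an identity for [ring] or
    [field]. *)
Lemma eq_by_linear_combination (R : pzRingType) (c x y z w : R) :
  x = y -> z - w = c * (x - y) -> z = w.
Proof. by move=> -> /eqP; rewrite subrr mulr0 subr_eq0 => /eqP. Qed.

(** With d the degree of p, multiplying p(-1/2) = 0 by (-2)^d turns the leading term into 1 and all
    others into even integers. *)
Lemma nonintegral_half (C : numClosedFieldType) :
  ~ integralOver (intr : int -> C) (- 2^-1).
Proof.
case=> p mon_p /rootP; rewrite horner_coef size_map_poly_id0; last first.
  by rewrite intr_eq0 lead_coef_eq0 monic_neq0.
have sz_p : (0 < size p)%N by rewrite size_poly_gt0 monic_neq0.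
case def_d: (size p) sz_p => [//|d] _; rewrite big_ord_recr /= coef_map /=.
have -> : p`_d = 1 by rewrite -(monicP mon_p) lead_coefE def_d.
move/(congr1 (fun z => (- 2) ^+ d * z)); rewrite mulr0 mulrDr mul1r.
have two_neq0 : (2 : C) != 0 by rewrite pnatr_eq0.
rewrite -exprMn mulrNN mulfV // expr1n mulr_sumr.
have -> : \sum_(i < d) (- 2) ^+ d * ((map_poly (intr : int -> C) p)`_i * (- 2^-1) ^+ i)
   = (2 * \sum_(i < d) (- ((- 2) ^+ (d - i.+1) * p`_i)))%:~R.
  rewrite mulr_sumr rmorph_sum; apply: eq_bigr => i _ /=; rewrite coef_map /=.
  rewrite mulrCA (_ : (- 2) ^+ d * _ = (- 2) ^+ (d - i)).
    by rewrite !(rmorphM, rmorphN, rmorphXn) /= -(subnSK (ltn_ord i)) exprS; ring.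
  rewrite -{1}(subnK (ltnW (ltn_ord i))) exprD -mulrA -exprMn mulrNN mulfV //.
  by rewrite expr1n mulr1.
move=> /eqP; rewrite -[1]/(1%:~R) -rmorphD intr_eq0 /=.
set s := \sum_(i < d) _; move/eqP/(congr1 (fun z => z %% 2)%Z).
by rewrite mulrC modzMDl.
Qed.

Lemma mulmx_delta_mxE (R : pzRingType) m n p q (A : 'M[R]_(m, n)) (B : 'M[R]_(p, q))
    i j k l : (A *m delta_mx j k *m B) i l = A i j * B k l.
Proof.
rewrite mxE (bigD1 k) //= big1 ?addr0 => [|h /negPf neq].
  rewrite mxE (bigD1 j) //= big1 ?addr0 => [|h /negPf neq].
    by rewrite mxE !eqxx mulr1.
  by rewrite mxE neq mulr0.
by rewrite mxE big1 ?mul0r // => h' _; rewrite mxE neq andbF mulr0.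
Qed.

(** * Dual bases and intertwining operators *)

Section Casimir.

Variables (C : numClosedFieldType) (r : nat).
Variables (lam : 'I_r.+1 -> 'I_r.+1 -> 'I_r.+1 -> C) (star : 'I_r.+1 -> 'I_r.+1).
Variable delta : 'I_r.+1 -> C.
Hypotheses (rbaA : is_RBA lam star) (degA : is_pos_degree_map lam star delta).

Lemma starK : involutive star.
Proof. by case: rbaA => _ [_ [_ []]]. Qed.

Lemma lam_star i j k : lam (star j) (star i) (star k) = lam i j k.
Proof. by case: rbaA => _ [_ [_ [_ []]]]. Qed.

Lemma lam_ord0 i j : lam i j ord0 = (j == star i)%:R * delta i.
Proof.
case: rbaA => _ [_ [_ [_ [_ [supp _]]]]]; case: degA => _ _ _ _ lam_diag.
case: eqP => [->|neq]; first by rewrite lam_diag mul1r.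
by rewrite mul0r; apply/eqP; apply: contra_notT neq => /supp.
Qed.

Lemma star0 : star ord0 = ord0.
Proof.
case: rbaA => _ [one [_ [_ [_ [supp _]]]]]; apply/esym/supp.
by rewrite (one _ _).1 eqxx oner_eq0.
Qed.

Lemma delta_neq0 i : delta i != 0.
Proof. by case: degA => _ _ _ pos _; rewrite gt_eqF. Qed.

Lemma delta_star i : delta (star i) = delta i.
Proof.
case: rbaA => _ [_ [_ [_ [_ [_ sym]]]]]; case: degA => _ _ _ _ lam_diag.
by rewrite -!lam_diag starK (sym i).1.
Qed.

(* Both sides are the coefficient of 1 in b_i b_j b_k. *)
Lemma lam_cycle i j k : lam i j (star k) * delta k = lam j k (star i) * delta i.
Proof.
case: rbaA => /(_ i j k ord0) assoc _.
rewrite (bigD1 (star k)) //= big1 ?addr0 in assoc; last first.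
  move=> l /negP neq; rewrite lam_ord0; case: eqP => [def_k|]; rewrite ?mul0r ?mulr0 //.
  by case: neq; rewrite def_k starK.
rewrite lam_ord0 starK eqxx mul1r delta_star in assoc; rewrite assoc.
rewrite (bigD1 (star i)) //= big1 ?addr0; last first.
  by move=> l /negPf neq; rewrite lam_ord0 neq mul0r mulr0.
by rewrite lam_ord0 eqxx mul1r.
Qed.

Definition mx_rep p (X : 'I_r.+1 -> 'M[C]_p) : Prop :=
  forall i j, X i *m X j = \sum_k lam i j k *: X k.

(** Analogue of the group average \sum_g X(g) M Y(g^-1). *)
Definition casimir p q (X : 'I_r.+1 -> 'M[C]_p) (Y : 'I_r.+1 -> 'M[C]_q)
    (M : 'M[C]_(p, q)) : 'M[C]_(p, q) :=
  \sum_i (delta i)^-1 *: (X i *m M *m Y (star i)).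

Lemma sum_star (V : nmodType) (F : 'I_r.+1 -> V) : \sum_i F (star i) = \sum_i F i.
Proof.
rewrite [RHS](reindex_inj (inv_inj starK)); exact: eq_bigr.
Qed.

(* The bases (b_i) and (b_i^* / delta_i) are dual for the form
   (a, b) |-> coefficient of 1 in a b. *)
Lemma casimir_intertwines p q (X : 'I_r.+1 -> 'M[C]_p) (Y : 'I_r.+1 -> 'M[C]_q) M k :
  mx_rep X -> mx_rep Y -> X k *m casimir X Y M = casimir X Y M *m Y k.
Proof.
move=> repX repY; rewrite mulmx_sumr mulmx_suml.
transitivity (\sum_i \sum_l
    (lam k i l / delta i) *: (X l *m M *m Y (star i))).
  apply: eq_bigr => i _; rewrite -scalemxAr !mulmxA repX !mulmx_suml scaler_sumr.
  by apply: eq_bigr => l _; rewrite -!scalemxAl scalerA mulrC.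
rewrite exchange_big /=; apply: eq_bigr => i _.
rewrite -scalemxAl -mulmxA repY mulmx_sumr scaler_sumr -sum_star.
apply: eq_bigr => l _; rewrite -scalemxAr scalerA starK delta_star; congr (_ *: _).
have := lam_cycle (star i) k (star l); rewrite !starK !delta_star => cyc.
apply: (mulIf (delta_neq0 l)); apply: (mulIf (delta_neq0 i)).
by rewrite divfK ?delta_neq0 // -cyc; field; rewrite delta_neq0.
Qed.

(** The contragredient of [X]: transposition and [star] both reverse products. *)
Lemma mx_rep_star p (X : 'I_r.+1 -> 'M[C]_p) :
  mx_rep X -> mx_rep (fun i => (X (star i))^T).
Proof.
move=> repX i j; rewrite -trmx_mul repX raddf_sum -sum_star /=.
by apply: eq_bigr => k _; rewrite linearZ /= lam_star.
Qed.

(** * Schur's lemma and orthogonality relations *)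

Variable rho : 'I_r.+1 -> 'M[C]_2.
Hypotheses (rep_rho : is_rep2 lam rho) (irr_rho : irreducible_rep2 rho).

Let rho_mul : mx_rep rho.
Proof. by case: rep_rho. Qed.

(** An eigenspace of [M] is invariant, hence everything. *)
Lemma schur_scalar (M : 'M[C]_2) :
  (forall i, rho i *m M = M *m rho i) -> exists a, M = a%:M.
Proof.
move=> comM; have [a ker_neq0] := eigenvalue_closed M (isT : 0 < 2)%N.
exists a; apply/eqP; rewrite -subr_eq0.
suff /row_fullP [L LK] : row_full (kermx (M - a%:M)).
  by rewrite -[_ - _]mul1mx -LK -mulmxA mulmx_ker mulmx0.
apply: irr_rho => [|i].
  exact: ker_neq0.
apply: comm_mx_stable_ker; rewrite /comm_mx mulmxBl mulmxBr comM.
by rewrite scalar_mxC.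
Qed.

Lemma intertwiner_unit (M : 'M[C]_2) (X : 'I_r.+1 -> 'M[C]_2) :
  (forall i, rho i *m M = M *m X i) -> M != 0 -> M \in unitmx.
Proof.
move=> rhoM M_neq0; rewrite -row_free_unit -kermx_eq0; apply: contraNT M_neq0.
move=> /irr_rho ker_full.
have /row_fullP [L LK] : row_full (kermx M).
  apply: ker_full => i; apply/sub_kermxP.
  by rewrite -mulmxA rhoM mulmxA mulmx_ker mul0mx.
by rewrite -[M]mul1mx -LK -mulmxA mulmx_ker mulmx0.
Qed.

(** The sum [W] intertwines the scalar action by [psi] with [rho]. If it were nonzero, its row space
    would be everything and [rho] would act by scalars, against irreducibility in dimension 2. *)
Lemma lin_char_orthogonal psi :
  is_lin_char lam psi -> \sum_i (psi i / delta i) *: rho (star i) = 0.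
Proof.
move=> [_ psiM]; set W := \sum_i _.
have W_rho k : W *m rho k = psi k *: W.
  pose X i : 'M[C]_2 := (psi i)%:M.
  have repX : mx_rep X.
    move=> i j; rewrite -scalar_mxM psiM raddf_sum; apply: eq_bigr => l _ /=.
    by rewrite scale_scalar_mx.
  have := casimir_intertwines 1%:M k repX rho_mul.
  rewrite (_ : casimir _ _ _ = W) ?mul_scalar_mx // /casimir /W.
  apply: eq_bigr => i _; rewrite mulmx1 mul_scalar_mx scalerA mulrC //.
apply/eqP; apply/negPn/negP => W_neq0.
have /row_fullP [L LK] : row_full W.
  by apply: irr_rho => // i; rewrite W_rho scalemx_sub.
have rhoE k : rho k = (psi k)%:M.
  by rewrite -[rho k]mul1mx -LK -mulmxA W_rho -scalemxAr LK scale_scalar_mx mulr1.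
have /row_fullP [K] : row_full (delta_mx ord0 ord0 : 'M[C]_2).
  apply: irr_rho => [|i]; last by rewrite rhoE mul_mx_scalar scalemx_sub.
  apply/eqP => /matrixP /(_ ord0 ord0) /eqP.
  by rewrite !mxE !eqxx oner_eq0.
move=> /matrixP /(_ ord_max ord_max); rewrite mxE big1 => [|j _].
  by rewrite mxE /= => /esym/eqP; rewrite oner_eq0.
by rewrite !mxE andbC mulr0.
Qed.

(** Schur's lemma yields the factor [p = t]; replacing i by its star exchanges the two matrix
    entries and yields [q = s]. *)
Lemma casimir_scalar : exists kap, forall p q s t,
  \sum_i rho i p q * rho (star i) s t / delta i = kap * ((p == t) && (q == s))%:R.
Proof.
have [g gE] : exists g, forall p q s t,
    \sum_i rho i p q * rho (star i) s t / delta i = (p == t)%:R * g q s.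
  exists (fun q s => casimir rho rho (delta_mx q s) ord0 ord0) => p q s t.
  have [a cas_a] : exists a, casimir rho rho (delta_mx q s) = a%:M.
    by apply: schur_scalar => i; exact: casimir_intertwines.
  rewrite [in RHS]cas_a mxE eqxx mulr1n.
  have /matrixP/(_ p t) := cas_a; rewrite [RHS]mxE mulr_natl => <-.
  rewrite summxE; apply: eq_bigr => i _.
  by rewrite mxE mulmx_delta_mxE mulrC.
exists (g ord0 ord0) => p q s t; rewrite gE.
have gsym a b c d : (a == d)%:R * g b c = (c == b)%:R * g d a.
  rewrite -!gE -sum_star; apply: eq_bigr => i _.
  by rewrite starK delta_star [rho _ _ _ * _]mulrC.
have := gsym ord0 q s ord0; rewrite eqxx mul1r => ->.
by rewrite mulrA -natrM mulnb eq_sym [RHS]mulrC [s == q]eq_sym.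
Qed.

Variable kap : C.
Hypothesis kapP : forall p q s t,
  \sum_i rho i p q * rho (star i) s t / delta i = kap * ((p == t) && (q == s))%:R.

Lemma casimir_mx M : casimir rho rho M = (kap * \tr M)%:M.
Proof.
apply/matrixP => p t; rewrite summxE.
transitivity (\sum_q \sum_s M q s * \sum_i rho i p q * rho (star i) s t / delta i).
  under [RHS]eq_bigr do under eq_bigr do rewrite mulr_sumr.
  under [RHS]eq_bigr do rewrite exchange_big /=.
  rewrite [RHS]exchange_big; apply: eq_bigr => i _ /=; rewrite !mxE mulr_sumr.
  under [LHS]eq_bigr do rewrite mxE mulr_suml mulr_sumr.
  rewrite exchange_big /=; apply: eq_bigr => q _; apply: eq_bigr => s _; ring.
under eq_bigr do under eq_bigr do rewrite kapP.
rewrite [RHS]mxE [\tr M]/mxtrace mulr_sumr -sumrMnl; apply: eq_bigr => q _.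
rewrite (bigD1 q) //= big1 ?addr0 => [|s /negPf neq].
  rewrite eqxx andbT; case: (p == t); rewrite ?mulr0n; ring.
by rewrite [q == s]eq_sym neq andbF !mulr0.
Qed.

(** Taken at the transpose of an intertwiner from [rho] to its contragredient, this tells whether
    the intertwiner is symmetric or antisymmetric. *)
Lemma casimir_trmx M :
  \sum_i (delta i)^-1 *: (rho i *m M *m (rho (star i))^T) = kap *: M^T.
Proof.
apply/matrixP => p t; rewrite summxE.
transitivity (\sum_q \sum_s M q s * \sum_i rho i p q * rho (star i) t s / delta i).
  under [RHS]eq_bigr do under eq_bigr do rewrite mulr_sumr.
  under [RHS]eq_bigr do rewrite exchange_big /=.
  rewrite [RHS]exchange_big; apply: eq_bigr => i _ /=; rewrite !mxE mulr_sumr.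
  under [LHS]eq_bigr do rewrite !mxE mulr_suml mulr_sumr.
  rewrite exchange_big /=; apply: eq_bigr => q _; apply: eq_bigr => s _; ring.
under eq_bigr do under eq_bigr do rewrite kapP.
rewrite !mxE (bigD1 t) //= [X in _ + X]big1 ?addr0 => [|q /negPf neq].
  rewrite (bigD1 p) //= big1 ?addr0 => [|s /negPf neq].
    by rewrite !eqxx mulr1 mulrC.
  by rewrite eq_sym neq !mulr0.
by rewrite big1 // => s _; rewrite neq andbF !mulr0.
Qed.

(** Up to [kap], an explicit preimage of [M] in A. *)
Lemma casimir_dual M : \sum_i (\tr (M *m rho (star i)) / delta i) *: rho i = kap *: M.
Proof.
apply/matrixP => p q; rewrite summxE.
transitivity (\sum_t \sum_s M t s * \sum_i rho i p q * rho (star i) s t / delta i).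
  under [RHS]eq_bigr do under eq_bigr do rewrite mulr_sumr.
  under [RHS]eq_bigr do rewrite exchange_big /=.
  rewrite [RHS]exchange_big; apply: eq_bigr => i _ /=; rewrite !mxE !mulr_suml.
  apply: eq_bigr => t _; rewrite mxE !mulr_suml; apply: eq_bigr => s _; ring.
under eq_bigr do under eq_bigr do rewrite kapP.
rewrite !mxE (bigD1 p) //= [X in _ + X]big1 ?addr0 => [|t /negPf neq].
  rewrite (bigD1 q) //= big1 ?addr0 => [|s /negPf neq].
    by rewrite !eqxx mulr1 mulrC.
  by rewrite [q == s]eq_sym neq andbF !mulr0.
by rewrite big1 // => s _; rewrite eq_sym neq !mulr0.
Qed.

Lemma order_eq_multiplicity_mul m :
  trace_multiplicity lam delta rho m -> rba_order delta = m * kap.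
Proof.
move=> [psi [c [lin_psi tauE]]].
have := casimir_dual 1%:M; rewrite -sum_star.
under eq_bigr do rewrite starK mul1mx delta_star.
move=> dual1.
have : \sum_i (std_trace delta i / delta i) *: rho (star i) = (m * kap)%:M.
  under eq_bigr do rewrite tauE mulrDl scalerDl.
  rewrite big_split /= [X in X + _](_ : _ = 0) ?add0r.
    under eq_bigr do rewrite -mulrA -scalerA.
    by rewrite -scaler_sumr dual1 scalerA scalemx1.
  under eq_bigr do rewrite mulr_suml scaler_suml.
  rewrite exchange_big big1 // => t _ /=.
  under eq_bigr do rewrite -mulrA -scalerA.
  by rewrite -scaler_sumr lin_char_orthogonal ?scaler0.
rewrite (bigD1 ord0) //= big1 ?addr0 => [|i /negPf neq]; last first.
  by rewrite /std_trace neq mulr0 mul0r scale0r.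
rewrite /std_trace eqxx mulr1 star0; case: degA => -> _ _ _ _.
case: rep_rho => -> _; rewrite divr1 scalemx1 => /matrixP/(_ ord0 ord0).
by rewrite !mxE eqxx !mulr1n.
Qed.

(** * Consequences of nu(chi) = -1, stated as [fs_rho] through n = m kap *)

Hypotheses (kap_neq0 : kap != 0)
  (fs_rho : \sum_i \tr (rho i *m rho i) / delta i = - (2 * kap)).

(** An intertwiner [P] from [rho] to its contragredient is antisymmetric, and conjugating a
    transposed 2x2 matrix by an antisymmetric one gives the adjugate. *)
Lemma rho_add_star i : rho i + rho (star i) = (\tr (rho i))%:M.
Proof.
pose rhoT j := (rho (star j))^T.
(* The nonzero sum in [fs_rho] is a sum of entries of these matrices. *)
have [q [s V_neq0]] : exists q s, casimir rho rhoT (delta_mx q s) != 0.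
  case: (pickP (fun qs => casimir rho rhoT (delta_mx qs.1 qs.2) != 0)).
    by move=> [q s]; exists q, s.
  move=> no_V; have /eqP[] : \sum_i \tr (rho i *m rho i) / delta i != 0.
    by rewrite fs_rho oppr_eq0 mulf_neq0 // pnatr_eq0.
  transitivity (\sum_q \sum_s casimir rho rhoT (delta_mx q s) s q).
    under [RHS]eq_bigr do under eq_bigr do rewrite summxE.
    under [RHS]eq_bigr do rewrite exchange_big /=.
    rewrite [RHS]exchange_big; apply: eq_bigr => j _ /=.
    rewrite [RHS]exchange_big mulr_suml; apply: eq_bigr => s _ /=.
    rewrite mxE mulr_suml; apply: eq_bigr => q _.
    by rewrite [RHS]mxE mulmx_delta_mxE /rhoT starK mxE mulrC.
  rewrite big1 // => q _; rewrite big1 // => s _.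
  by have /negbFE/eqP -> := no_V (q, s); rewrite mxE.
set P := casimir _ _ _ in V_neq0.
have rhoP k : rho k *m P = P *m rhoT k.
  by apply: casimir_intertwines => //; apply: mx_rep_star.
have uP : P \in unitmx by apply: intertwiner_unit V_neq0.
have rhoPT k : rho k *m P^T = P^T *m rhoT k.
  by rewrite -[LHS]trmxK trmx_mul trmxK -{1}[k]starK -rhoP trmx_mul.
have uPT : P^T \in unitmx by rewrite unitmx_tr.
(* [P] and its transpose are invertible intertwiners of the same representations. *)
have [a aE] : exists a, P *m invmx P^T = a%:M.
  apply: schur_scalar => k; rewrite mulmxA rhoP -!mulmxA; congr (_ *m _).
  by apply: (row_free_inj (A := P^T)); rewrite ?row_free_unit // -!mulmxA rhoPT
    mulVmx // mulmx1 mulKmx.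
(* a is the Frobenius--Schur indicator. *)
have a_N1 : a = -1.
  apply: (mulfI kap_neq0).
  have : \tr (\sum_i (delta i)^-1 *: (rho i *m P^T *m rhoT i) *m invmx P^T)
      = - (2 * kap).
    rewrite raddf_sum -fs_rho /=; apply: eq_bigr => k _.
    rewrite -scalemxAl mxtraceZ mulrC -!mulmxA; congr (\tr (_ *m _) / _).
    by rewrite mulmxA -rhoPT mulmxK.
  rewrite -mulmx_suml casimir_trmx trmxK -scalemxAl aE mxtraceZ mxtrace_scalar.
  move=> E; apply: (mulIf (_ : 2 != 0)); first by rewrite pnatr_eq0.
  by rewrite -mulrA mulr_natr E; ring.
have PT : P = - P^T.
  by rewrite -[LHS](mulmxKV uPT) aE a_N1 mul_scalar_mx scaleN1r.
have P00 j : P j j = 0.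
  move/matrixP/(_ j j): PT; rewrite !mxE => /eqP.
  by rewrite -addr_eq0 -mulr2n mulrn_eq0 => /eqP.
pose o1 : 'I_2 := lift ord0 ord0.
have ord2P (p : 'I_2) : p = ord0 \/ p = o1.
  by case: (unliftP ord0 p) => [p'|] ->; [right; rewrite [p']ord1 | left].
have P10 : P o1 ord0 = - P ord0 o1 by rewrite [in LHS]PT !mxE.
have P01 : P ord0 o1 != 0.
  apply: contraNneq V_neq0 => P0; apply/eqP/matrixP => p t; rewrite mxE.
  by case: (ord2P p) (ord2P t) => -> [] ->; rewrite ?P00 // ?P10 P0 ?oppr0.
have rhoPE p t : rho i p ord0 * P ord0 t + rho i p o1 * P o1 t
    = P p ord0 * rho (star i) t ord0 + P p o1 * rho (star i) t o1.
  have /matrixP/(_ p t) := rhoP i.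
  by rewrite !mxE !big_ord_recl !big_ord0 !addr0 /rhoT !mxE.
(* Multiplied by the only free entry of [P], each entry of the goal becomes an entry of the
   intertwining relation. *)
apply/matrixP => p t; rewrite !mxE /mxtrace big_ord_recl big_ord1 -/o1.
case: (ord2P p) (ord2P t) => -> [] ->; apply: (mulIf P01).
- apply: (eq_by_linear_combination (c := 1) (rhoPE o1 ord0)).
  rewrite !P00 P10 /= mulr1n; ring.
- apply: (eq_by_linear_combination (c := 1) (esym (rhoPE ord0 ord0))).
  rewrite !P00 P10 /= mulr0n; ring.
- apply: (eq_by_linear_combination (c := 1) (rhoPE o1 o1)).
  rewrite !P00 P10 /= mulr0n; ring.
apply: (eq_by_linear_combination (c := 1) (esym (rhoPE ord0 o1))).
rewrite !P00 /= mulr1n; ring.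
Qed.

Lemma rho_star i : rho (star i) = (\tr (rho i))%:M - rho i.
Proof. by rewrite -rho_add_star addrC addKr. Qed.

Lemma mxtrace_rho_star i : \tr (rho (star i)) = \tr (rho i).
Proof. by rewrite rho_star raddfB /= mxtrace_scalar; ring. Qed.

Lemma mxtrace_mul_rho_star (M : 'M[C]_2) i :
  \tr (M *m rho (star i)) = \tr M * \tr (rho i) - \tr (M *m rho i).
Proof. by rewrite rho_star mulmxBr mul_mx_scalar raddfB /= mxtraceZ mulrC. Qed.

(* The first factor projects onto the complement of the 2x2 block of A; half of
   the second one projects onto the antisymmetric elements. *)
Definition skew_defect : 'M[C]_r.+1 :=
  (1%:M - \matrix_(i, j) (\tr (rho i *m rho (star j)) / (kap * delta j)))
  *m (1%:M - \matrix_(i, j) (j == star i)%:R).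

(* The defect is twice an idempotent. With Q the projection onto the 2x2 block
   and S the matrix of the involution, its trace is
   tr 1 - tr Q - tr S + tr (Q S) = (r + 1) - 4 - tr S - 2. *)
Lemma skew_defect_rank :
  ((\rank skew_defect).*2 + #|[pred i | star i == i]| + 5 = r)%N.
Proof.
rewrite /skew_defect.
set Q := \matrix_(i, j) (_ / _); set S := \matrix_(i, j) _.
have Sl M : S *m M = \matrix_(i, j) M (star i) j.
  apply/matrixP => i j; rewrite !mxE (bigD1 (star i)) //= big1 => [|k /negPf neq].
    by rewrite mxE eqxx mul1r addr0.
  by rewrite mxE neq mul0r.
have Sr M : M *m S = \matrix_(i, j) M i (star j).
  apply/matrixP => i j; rewrite !mxE (bigD1 (star j)) //= big1 => [|k /negPf neq].
    by rewrite mxE starK eqxx mulr1 addr0.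
  by rewrite mxE -(inj_eq (inv_inj starK)) starK eq_sym neq mulr0.
have SS : S *m S = 1%:M.
  by rewrite Sl; apply/matrixP => i j; rewrite !mxE starK eq_sym.
have QS : Q *m S = S *m Q.
  rewrite Sl Sr; apply/matrixP => i j; rewrite !mxE starK delta_star.
  congr (_ / _).
  by rewrite !mxtrace_mul_rho_star mxtrace_rho_star
    [\tr (rho (star i) *m _)]mxtrace_mulC
    mxtrace_mul_rho_star [\tr (rho j *m _)]mxtrace_mulC; ring.
(* By [casimir_dual], [rho] does not distinguish b_i from the element with coefficients in row i of
   [Q]. *)
have QQ : Q *m Q = Q.
  apply/matrixP => i j; rewrite [RHS]mxE mxE.
  have /(congr1 (fun M => \tr (M *m rho (star j)))) := casimir_dual (rho i).
  rewrite mulmx_suml raddf_sum -scalemxAl mxtraceZ /= => E.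
  apply: (mulIf kap_neq0); rewrite [in RHS]mulrC mulrA -E !mulr_suml.
  apply: eq_bigr => k _; rewrite !mxE -scalemxAl mxtraceZ; field.
  by rewrite kap_neq0 !delta_neq0.
have D2 : (1%:M - Q) *m (1%:M - S) *m ((1%:M - Q) *m (1%:M - S))
    = 2 *: ((1%:M - Q) *m (1%:M - S)).
  have comm : (1%:M - S) *m (1%:M - Q) = (1%:M - Q) *m (1%:M - S).
    by rewrite !mulmxBl !mulmxBr !mul1mx !mulmx1 QS !opprB !addrA
      [LHS]addrAC [RHS]addrAC [1%:M - S - Q]addrAC.
  rewrite -mulmxA [(1%:M - S) *m _]mulmxA comm !mulmxA.
  have -> : (1%:M - Q) *m (1%:M - Q) = 1%:M - Q.
    by rewrite mulmxBl mul1mx mulmxBr mulmx1 QQ subrr subr0.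
  rewrite -mulmxA; have -> : (1%:M - S) *m (1%:M - S) = 2 *: (1%:M - S).
    rewrite mulmxBl mul1mx mulmxBr mulmx1 SS; apply/matrixP => i j.
    by rewrite !mxE; ring.
  by rewrite -scalemxAr.
set D := (1%:M - Q) *m (1%:M - S) in D2 *.
have trD : \tr D = (\rank D).*2%:R.
  have two_neq0 : (2 : C) != 0 by rewrite pnatr_eq0.
  have /mxtrace_idempotent : (2^-1 *: D) *m (2^-1 *: D) = 2^-1 *: D.
    by rewrite -scalemxAl -scalemxAr D2 !scalerA -mulrA mulVf ?mulr1.
  rewrite mxtraceZ eqmx_scale ?invr_eq0 // -muln2 natrM => <-.
  by rewrite mulrC mulrA mulfV ?mul1r.
have trQ : \tr Q = 4.
  have := congr1 mxtrace (casimir_mx 1%:M).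
  rewrite mxtrace_scalar mxtrace1 raddf_sum /= => E.
  apply: (mulfI kap_neq0); rewrite mulr_sumr.
  transitivity (kap * 2%:R *+ 2); last by ring.
  rewrite -E; apply: eq_bigr => i _; rewrite mxE mxtraceZ mulmx1; field.
  by rewrite kap_neq0 delta_neq0.
have trQS : \tr (Q *m S) = - 2.
  apply: (mulfI kap_neq0); rewrite Sr mulr_sumr.
  transitivity (- (2 * kap)); last by ring.
  rewrite -fs_rho; apply: eq_bigr => i _; rewrite !mxE starK delta_star; field.
  by rewrite kap_neq0 delta_neq0.
have trS : \tr S = #|[pred i | star i == i]|%:R.
  rewrite -sum1_card natr_sum big_mkcond; apply: eq_bigr => i _.
  by rewrite mxE inE eq_sym; case: (_ == _).
have : \tr D = r%:R - 5 - \tr S.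
  rewrite /D mulmxBl !mulmxBr !mul1mx mulmx1 !raddfB /= mxtrace1 trQ trQS.
  by rewrite -natr1; ring.
rewrite trD trS => E; apply/eqP; rewrite -(eqr_nat C) !natrD E; apply/eqP; ring.
Qed.

(** * Structure constants when all skew elements lie in the 2x2 block *)

Hypothesis no_skew_defect : skew_defect = 0.

(** By [rho_star], the left side is -1/2 times the trace of the product of the images of b_i - b_i^*
    and b_k - b_k^*. *)
Lemma mxtrace_mul_skew i k :
  \tr (rho i) * \tr (rho k) - 2 * \tr (rho i *m rho k)
    = kap * delta k * ((i == k)%:R - (k == star i)%:R).
Proof.
have /matrixP/(_ i k) := no_skew_defect; rewrite /skew_defect.
rewrite mulmxBr mulmx1 !mxE (bigD1 (star k)) //= big1 => [|j /negPf neq]; last first.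
  by rewrite !mxE [k == star j]eq_sym (inv_eq starK) neq mulr0.
rewrite !mxE starK eqxx delta_star !addr0 mulr1 mxtrace_mul_rho_star.
rewrite [k == star i]eq_sym (inv_eq starK).
move/(eq_by_linear_combination (c := - (kap * delta k))); apply.
by field; rewrite kap_neq0 delta_neq0.
Qed.

Lemma half_char_structure_constant i j : star j != j -> i != j -> i != star j ->
  \tr (rho i) / 2 = lam j i j - lam (star j) i j.
Proof.
move=> j_skew ij ij'; have two_neq0 : (2 : C) != 0 by rewrite pnatr_eq0.
apply: (mulfI (mulf_neq0 kap_neq0 (delta_neq0 j))).
(* The bracket is the image of b_i b_j^* minus its star. Expanded in the basis and paired with b_j,
   it keeps only the terms k = j and k = j^*. *)
have -> : kap * delta j * (lam j i j - lam (star j) i j)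
   = \tr (rho j *m (rho i *m rho (star j) - rho j *m rho (star i))).
  transitivity (\sum_k lam i (star j) (star k)
      * (kap * delta k * ((j == k)%:R - (k == star j)%:R))).
    transitivity (\sum_k kap * delta j * lam k i j * ((j == k)%:R - (k == star j)%:R)).
      rewrite (bigD1 j) //= (bigD1 (star j)) //= big1 ?addr0.
        by rewrite !eqxx [j == _]eq_sym (negPf j_skew) /=; ring.
      by move=> k /andP[/negPf kj /negPf kj']; rewrite eq_sym kj kj' subrr mulr0.
    apply: eq_bigr => k _; have := lam_cycle k i (star j).
    rewrite starK delta_star => cyc.
    apply: (eq_by_linear_combination
      (c := kap * ((j == k)%:R - (k == star j)%:R)) cyc); ring.
  rewrite mulmxBr !rho_mul !mulmx_sumr raddfB /=.
  rewrite raddf_sum [X in _ - X]raddf_sum /= -[X in X - _]sum_star -sumrB.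
  apply: eq_bigr => k _; rewrite -mxtrace_mul_skew -!scalemxAr !mxtraceZ.
  by rewrite mxtrace_mul_rho_star -(lam_star j (star i)) starK; ring.
(* Next, the same trace is evaluated inside the 2x2 block, where b_i - b_i^* is orthogonal to b_j -
   b_j^*. *)
have := mxtrace_mul_skew j j; have := mxtrace_mul_skew j i.
rewrite [j == i]eq_sym (negPf ij) (negPf ij') [j == star j]eq_sym (negPf j_skew) eqxx.
rewrite subrr mulr0 /= => trij trjj.
rewrite mulmxBr raddfB /= !mulmxA !mxtrace_mul_rho_star.
rewrite [\tr (rho j *m rho i *m _)]mxtrace_mulC mulmxA.
have {trij} -> : \tr (rho j *m rho i) = \tr (rho j) * \tr (rho i) / 2.
  by apply: (eq_by_linear_combination (c := - 2^-1) trij); field.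
have -> : \tr (rho j *m rho j) = (\tr (rho j) ^+ 2 - kap * delta j) / 2.
  by apply: (eq_by_linear_combination (c := - 2^-1) trjj); field.
by field.
Qed.

(** Orthogonality of chi to the linear character [delta]. *)
Lemma sum_char_eq0 : \sum_i \tr (rho i) = 0.
Proof.
have delta_char : is_lin_char lam delta by case: degA.
have /(congr1 mxtrace) := lin_char_orthogonal delta_char.
rewrite raddf_sum mxtrace0 => chi0; rewrite -[RHS]chi0 -[LHS]sum_star.
apply: eq_bigr => i _ /=.
by rewrite mxtraceZ divff ?delta_neq0 ?mul1r.
Qed.

End Casimir.

(** * Rank 7 *)

Lemma alg_integer_integralOver (C : numClosedFieldType) (x : C) :
  alg_integer x -> integralOver (intr : int -> C) x.
Proof. by case=> p [mon_p root_p]; exists p. Qed.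

(* Rank 7: basis indexed by 'I_7 = 'I_(6.+1). *)
Theorem theorem2 (C : numClosedFieldType)
  (lam : 'I_7 -> 'I_7 -> 'I_7 -> C) (star : 'I_7 -> 'I_7) (delta : 'I_7 -> C)
  (rho : 'I_7 -> 'M[C]_2) (m : C) :
  is_RBA lam star ->
  is_pos_degree_map lam star delta ->
  noncommutative lam ->
  is_rep2 lam rho -> irreducible_rep2 rho ->
  trace_multiplicity lam delta rho m ->
  FS_indicator lam delta rho m = -1 ->
  ~ (forall i j k, alg_integer (lam i j k)).
Proof.
move=> rbaA degA _ rep_rho irr_rho tau_m fs_m lam_int.
have [kap kapP] := casimir_scalar rbaA degA rep_rho irr_rho.
have order_m := order_eq_multiplicity_mul rbaA degA rep_rho irr_rho kapP tau_m.
have chi0 : char_of rho ord0 = 2 by rewrite /char_of rep_rho.1 mxtrace1.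
have [two_neq0 N1_neq0] : (2 : C) != 0 /\ (- 1 : C) != 0.
  by rewrite pnatr_eq0 oppr_eq0 oner_eq0.
rewrite /FS_indicator order_m chi0 in fs_m.
(* If [m] or [kap] vanished, the indicator would be 0, since the inverse of 0 is 0. *)
have m_neq0 : m != 0.
  by apply: contra_neq N1_neq0 => m0; rewrite -fs_m m0 !mul0r.
have kap_neq0 : kap != 0.
  by apply: contra_neq N1_neq0 => k0; rewrite -fs_m k0 mulr0 mul0r invr0 mulr0 mul0r.
have fs_rho : \sum_i \tr (rho i *m rho i) / delta i = - (2 * kap).
  have m_nz : m / (m * kap * 2) != 0 by rewrite mulf_neq0 ?invr_neq0 ?mulf_neq0.
  apply: (mulfI m_nz).
  transitivity (- 1 : C); last by field; rewrite m_neq0 kap_neq0.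
  rewrite -[RHS]fs_m; congr (_ * _); apply: eq_bigr => i _; congr (_ / _).
  by rewrite rep_rho.2 raddf_sum; apply: eq_bigr => k _ /=; rewrite mxtraceZ.
have := skew_defect_rank rbaA degA rep_rho irr_rho kapP kap_neq0 fs_rho.
(* Here r = 6, so twice the rank plus the number of symmetric basis elements is 1. As b_0 is
   symmetric, the rank is 0. *)
rewrite -[X in _ = X]/(1 + 5)%N => /addIn rk1.
have sym_ord0 : ord0 \in [pred i | star i == i] by rewrite inE (star0 rbaA).
have : (0 < #|[pred i | star i == i]|)%N by apply/card_gt0P; exists ord0.
case: (\rank _) (@mxrank_eq0 _ _ _ (skew_defect star delta rho kap)) rk1; last first.
  by move=> rk _; rewrite doubleS !addSn; case: #|_|.
rewrite eqxx add0n => /esym/eqP no_skew card1 _.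
have skew i : i != ord0 -> star i != i.
  move=> i0; apply/negP => sym_i; have := card_le1_eqP (eq_leq card1).
  by move/(_ i ord0 sym_i sym_ord0)/esym/eqP; rewrite (negPf i0).
have half_int i : i != ord0 -> integralOver (intr : int -> C) (\tr (rho i) / 2).
  (* Three indices cannot exhaust the seven available. *)
  move=> i0; have [j] : exists j, j \notin [:: ord0; i; star i].
    apply/existsP; rewrite -negb_forall; apply/negP => /forallP all_in.
    have := uniq_leq_size (enum_uniq 'I_7) (fun j _ => all_in j).
    by rewrite size_enum_ord.
  rewrite !inE !negb_or => /and3P[j0 ji jsi].
  rewrite (half_char_structure_constant rbaA degA rep_rho irr_rho kapP kap_neq0
    fs_rho no_skew (skew j j0)).
  - by apply: integral_sub; apply: alg_integer_integralOver.
  - by rewrite eq_sym.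
  by rewrite eq_sym (inv_eq (starK rbaA)).
have star_ord0 i : (star i == ord0) = (i == ord0).
  by rewrite (inv_eq (starK rbaA)) (star0 rbaA).
have mxtrace_star := mxtrace_rho_star rbaA degA rep_rho irr_rho kapP kap_neq0 fs_rho.
have := sum_char_eq0 rbaA degA rep_rho irr_rho.
(* The condition i < star i selects one element of each pair, so the vanishing sum reads 2 + 2
   [upper] = 0. *)
rewrite (bigD1 ord0) //= [\tr _]chi0 (bigID (fun i : 'I_7 => (i < star i)%N)) /=.
set upper := \sum_(i | _ && _) _; set lower := \sum_(i | _ && _) _.
have -> : lower = upper.
  rewrite /lower (reindex_inj (inv_inj (starK rbaA))) /=.
  apply: eq_big => [i|i _]; last exact: mxtrace_star.
  rewrite star_ord0 (starK rbaA) -leqNgt leq_eqVlt; case: eqVneq => //= i0.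
  by rewrite (inj_eq val_inj) eq_sym (negPf (skew i i0)).
move=> upperE; have upper_half : upper / 2 = - 2^-1.
  by apply: (eq_by_linear_combination (c := 4^-1) upperE); field.
apply: (@nonintegral_half C); rewrite -upper_half /upper mulr_suml.
elim/big_ind: _ => [|x y x_int y_int|i /andP[i0 _]]; last exact: half_int.
  exact: integral0.
exact: integral_add.
Qed.
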